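(* For every $n\ge1$, the graph composihedron of the complete graph $K_n$ on $n$ nodes is combinatorially equivalent to the stellohedron $\mathcal{K}St_n$, the graph associahedron of the star graph with $n+1$ nodes. That is, the poset $(\mathcal{J}K_n)_d$ of marked tubings of $K_n$ modulo the equivalence defined in the context is isomorphic to the poset $\mathrm{Tub}(St_n)$ of tubings of the star graph $St_n$.
   Context: **Tubings.** For a finite connected simple graph $G$, a tube is a nonempty set of nodes inducing a connected subgraph; the set of all nodes is the universal tube. Two tubes $u,v$ are compatible if one is contained in the other or if $u\cup v$ is not a tube (and $u,v$ disjoint). A tubing is a set of pairwise compatible tubes containing the universal tube. $\mathrm{Tub}(G)$ is the set of tubings ordered by $U\preceq U'$ iff $U'\subseteq U$; it is the face poset of the graph associahedron $\mathcal{K}G$. The star graph $St_n$ has nodes $0,1,\dots,n$ and edges $\{0,i\}$, $1\le i\le n$. **Marked tubings.** A marked tube is a tube marked thin, thick or broken. A marked tubing is a tubing with each tube (including the universal one) marked, such that whenever $u\subsetneq v$ are tubes of it and $v$ is not thick, then $u$ is thin. Marked tubings of $G$ are partially ordered by $U\preceq U'$ if $U$ is obtained from $U'$ by a finite sequence of the following moves, each resulting in a marked tubing: (1) a broken tube becomes thin or thick; (2) a thin tube is added inside a thin or broken tube; (3) a thick tube is added inside a thick tube; (4) a collection of compatible broken tubes $u_1,\dots,u_k$ is added simultaneously inside a broken tube $v$, with each $u_i$ closely nested in $v$ (no tube of the tubing strictly between $u_i$ and $v$), and $v$ becomes thick. This is the face poset of the graph multiplihedron $\mathcal{J}G$. **Graph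 composihedron.** The graph composihedron $\mathcal{J}G_d$ is the polytope whose face poset is the poset of marked tubings modulo the equivalence relation generated by $U\sim V$ whenever $U$ is obtained from $V$ by adding a thin tube inside another thin tube (with the order induced on classes). Each class is represented by a marked tubing with no thin tube inside another thin tube. *)

(* Defs.v *)
From HB Require Import structures.
From mathcomp Require Import all_boot.

Set Implicit Arguments.
Unset Strict Implicit.
Unset Printing Implicit Defensive.

Local Open Scope quotient_scope.

Record sgraph := SGraph {
  vertex :> finType;
  adj : rel vertex;
  adj_sym : symmetric adj;
  adj_irrefl : irreflexive adj }.

Section Tubings.
Variable G : sgraph.

Definition induced_adj (u : {set G}) : rel G :=
  [rel x y | [&& x \in u, y \in u & adj x y]].

Definition is_tube (u : {set G}) : bool :=
  (u != set0) && [forall x in u, forall y in u, connect (induced_adj u) x y].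

Definition connected_graph : bool := is_tube [set: G].

Definition compatible (u v : {set G}) : bool :=
  [|| u \subset v, v \subset u | [disjoint u & v] && ~~ is_tube (u :|: v)].

Definition is_tubing (U : {set {set G}}) : bool :=
  [&& [set: G] \in U,
      [forall u in U, is_tube u]
    & [forall u in U, forall v in U, compatible u v]].

Definition tubing : Type := {U : {set {set G}} | is_tubing U}.

(* Reverse inclusion: more tubes means a smaller face. *)
Definition tubing_le : rel tubing := fun U U' => val U' \subset val U.

End Tubings.

Inductive mark := Thin | Thick | Broken.

Definition mark_code (a : mark) : option bool :=
  match a with Thin => Some false | Thick => Some true | Broken => None end.
Definition mark_decode (o : option bool) : mark :=
  match o with Some false => Thin | Some true => Thick | None => Broken end.
Lemma mark_codeK : cancel mark_code mark_decode. Proof. by case. Qed.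
HB.instance Definition _ := Finite.copy mark (can_type mark_codeK).

Section MarkedTubings.
Variable G : sgraph.

(* [m u = None] means that [u] does not belong to the tubing. *)
Notation marking := {ffun {set G} -> option mark}.

Definition tubes_of (m : marking) : {set {set G}} := [set u | m u != None].

Definition is_marked_tubing (m : marking) : bool :=
  is_tubing (tubes_of m) &&
  [forall u in tubes_of m, forall v in tubes_of m,
     (u \proper v) && (m v != Some Thick) ==> (m u == Some Thin)].

Record marked_tubing := MarkedTubing {
  marks :> marking;
  _ : is_marked_tubing marks }.

HB.instance Definition _ := [isSub for marks].
HB.instance Definition _ := [Finite of marked_tubing by <:].

(* Overrides the mark of [u], adding [u] to the tubing if it is absent. *)
Definition set_mark (m : marking) (u : {set G}) (a : mark) : marking :=
  [ffun w => if w == u then Some a else m w].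

Definition set_marks (m : marking) (B : {set {set G}}) (a : mark) : marking :=
  [ffun w => if w \in B then Some a else m w].

(* In all the moves below, [U] is obtained from [W]; since [U] is a
   [marked_tubing], the result of a move is valid by typing. *)
Implicit Types W U : marked_tubing.

Definition move_resolve W U : bool :=
  [exists v, exists a : mark,
     [&& W v == Some Broken, a != Broken & marks U == set_mark W v a]].

Definition move_add_thin W U : bool :=
  [exists v, exists u : {set G},
     [&& (W v == Some Thin) || (W v == Some Broken), u \proper v,
         W u == None & marks U == set_mark W u Thin]].

Definition move_add_thick W U : bool :=
  [exists v, exists u : {set G},
     [&& W v == Some Thick, u \proper v,
         W u == None & marks U == set_mark W u Thick]].

Definition closely_nested W (u v : {set G}) : bool :=
  (u \proper v) &&
  [forall w in tubes_of W, ~~ ((u \proper w) && (w \proper v))].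

Definition move_add_broken W U : bool :=
  [exists v, exists B : {set {set G}},
     [&& W v == Some Broken, B != set0,
         [forall u in B, (W u == None) && closely_nested W u v],
         [forall u in B, forall u' in B, compatible u u']
       & marks U == set_mark (set_marks W B Broken) v Thick]].

Definition move W U : bool :=
  [|| move_resolve W U, move_add_thin W U, move_add_thick W U
    | move_add_broken W U].

(* [move W U] goes down in the face order, from [W] to [U]. *)
Definition marked_le : rel marked_tubing := fun U U' => connect move U' U.

Definition thin_in_thin W U : bool :=
  [exists v, exists u : {set G},
     [&& W v == Some Thin, u \proper v,
         W u == None & marks U == set_mark W u Thin]].

Definition compo_equiv : rel marked_tubing :=
  connect [rel W U | thin_in_thin W U || thin_in_thin U W].

Lemma compo_equiv_refl : reflexive compo_equiv.
Proof. by move=> U; apply: connect0. Qed.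

Lemma compo_equiv_sym : symmetric compo_equiv.
Proof. by apply: sym_connect_sym => W U /=; rewrite orbC. Qed.

Lemma compo_equiv_trans : transitive compo_equiv.
Proof. exact: connect_trans. Qed.

Canonical compo_equiv_rel :=
  EquivRel compo_equiv compo_equiv_refl compo_equiv_sym compo_equiv_trans.

Definition composihedron : Type := {eq_quot compo_equiv_rel}.

(* A class lies below another when some representatives do. No transitive
   closure is taken: a thin tube strictly inside a thin tube stays compatible
   with everything that later moves can add or modify. *)
Definition compo_le : rel composihedron := fun x y =>
  [exists U : marked_tubing, exists V : marked_tubing,
     [&& \pi_({eq_quot compo_equiv_rel}) U == x,
         \pi_({eq_quot compo_equiv_rel}) V == y & marked_le U V]].

End MarkedTubings.

Definition complete_adj (n : nat) : rel 'I_n := fun i j => i != j.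

Lemma complete_adj_sym n : symmetric (@complete_adj n).
Proof. by move=> i j; rewrite /complete_adj eq_sym. Qed.

Lemma complete_adj_irrefl n : irreflexive (@complete_adj n).
Proof. by move=> i; rewrite /complete_adj eqxx. Qed.

Definition complete_graph (n : nat) : sgraph :=
  SGraph (@complete_adj_sym n) (@complete_adj_irrefl n).

Definition star_adj (n : nat) : rel 'I_n.+1 :=
  fun i j => (i != j) && ((i == ord0) || (j == ord0)).

Lemma star_adj_sym n : symmetric (@star_adj n).
Proof. by move=> i j; rewrite /star_adj eq_sym orbC. Qed.

Lemma star_adj_irrefl n : irreflexive (@star_adj n).
Proof. by move=> i; rewrite /star_adj eqxx. Qed.

Definition star_graph (n : nat) : sgraph :=
  SGraph (@star_adj_sym n) (@star_adj_irrefl n).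

Lemma complete_graph_connected n : 0 < n -> connected_graph (complete_graph n).
Proof.
case: n => // n _; apply/andP; split.
  by apply/set0Pn; exists ord0; rewrite inE.
apply/forall_inP => x _; apply/forall_inP => y _.
have [-> | neq_xy] := eqVneq x y; first exact: connect0.
by apply: connect1; rewrite /induced_adj /= !in_setT.
Qed.

Lemma star_graph_connected n : connected_graph (star_graph n).
Proof.
apply/andP; split; first by apply/set0Pn; exists ord0; rewrite inE.
have c0 (x : star_graph n) : connect (induced_adj [set: star_graph n]) x ord0.
  have [-> | neq_x0] := eqVneq x ord0; first exact: connect0.
  by apply: connect1; rewrite /induced_adj /= !in_setT /= /star_adj neq_x0 eqxx orbT.
apply/forall_inP => x _; apply/forall_inP => y _.
have symc : symmetric (connect (induced_adj [set: star_graph n])).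
  apply: sym_connect_sym => a b.
  by rewrite /induced_adj /= !in_setT /= star_adj_sym.
by apply: connect_trans (c0 x) _; rewrite symc.
Qed.

Definition poset_isomorphic (A B : Type) (leA : rel A) (leB : rel B) : Prop :=
  exists f : A -> B, bijective f /\ forall x y, leA x y = leB (f x) (f y).

(* Main.v *)
(** Tubings of K_n are chains of nonempty subsets of [n]. A tubing of St_n is a
    chain C of (possibly empty) subsets of [n] containing [n], encoded as the tubes
    {0} ∪ S for S in C, together with a set A of leaves contained in every member
    of C. To a marked tubing of K_n associate A = the union of its thin tubes and
    C = its thick tubes together with D = the union of its non-thick tubes. Adding
    thin tubes inside thin tubes does not change (A, C), and (A, C) determines
    the class. Moves only enlarge A and C; conversely, whenever (A, C) is strictly
    contained in the data of a star tubing, some move adds the missing part of A at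
    once or one missing member of C, which gives both surjectivity and
    the reverse implication for the orders. *)

Require Import Defs.
From mathcomp Require Import all_boot.

Set Implicit Arguments.
Unset Strict Implicit.
Unset Printing Implicit Defensive.

(** * Chains of subsets and their unions *)

Definition chain (T : finType) (F : {set {set T}}) : Prop :=
  {in F &, forall u v : {set T}, (u \subset v) || (v \subset u)}.

(** A member of maximal cardinality contains every other member, so it equals the union. *)
Lemma chain_cover (T : finType) (F : {set {set T}}) :
  chain F -> F = set0 \/ cover F \in F.
Proof.
move=> chF; have [->|[u0 Fu0]] := set_0Vmem F; [by left | right].
have [u Fu umax] := arg_maxnP (fun u : {set T} => #|u|) Fu0.
suff -> : cover F = u by [].
apply/eqP; rewrite eqEsubset bigcup_sup // andbT.
apply/bigcupsP => v Fv; have /orP[//|suv] := chF v u Fv Fu.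
by have /eqP <- : u == v by rewrite eqEcard suv; apply: umax.
Qed.

Lemma cover_sup (T : finType) (F : {set {set T}}) u :
  u \in F -> u \subset cover F.
Proof. exact: bigcup_sup. Qed.

Lemma coverS (T : finType) (F F' : {set {set T}}) :
  F \subset F' -> cover F \subset cover F'.
Proof.
by move=> /subsetP sFF'; apply/bigcupsP => u /sFF'; apply: cover_sup.
Qed.

(** * Marked tubings of the complete graph *)

Section Complete.
Variable n : nat.
Local Notation K := (complete_graph n).
Implicit Types (m : {ffun {set K} -> option mark}) (U V W : marked_tubing K).
Implicit Types (u v w : {set K}).

Lemma complete_is_tube u : is_tube u = (u != set0).
Proof.
rewrite /is_tube; case: eqP => //= _; apply/forall_inP => x ux.
apply/forall_inP => y uy; have [->|neq_xy] := eqVneq x y; first exact: connect0.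
by apply: connect1; rewrite /induced_adj /= ux uy.
Qed.

(** The union with a nonempty set is again a tube of $K_n$, so disjointness never makes two tubes
    compatible and only nesting remains. *)
Lemma complete_compatible u v :
  u != set0 -> compatible u v = (u \subset v) || (v \subset u).
Proof.
move=> /set0Pn[x ux]; rewrite /compatible complete_is_tube.
suff -> : u :|: v != set0 by rewrite andbF orbF.
by apply/set0Pn; exists x; rewrite inE ux.
Qed.

(** Working form of validity over $K_n$: since every nonempty set is a tube, [m set0 = None] says
    that all marked sets are tubes, and compatibility amounts to being a chain. *)
Lemma marked_tubingP m : reflect
  [/\ m setT != None, m set0 = None, chain (tubes_of m)
    & forall u v, u \proper v -> m u != None -> m v != None ->
        m v != Some Thick -> m u = Some Thin]
  (is_marked_tubing m).
Proof.
apply: (iffP andP) => [[/and3P[]]|[mT m0 chm thinm]].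
  rewrite inE => mT /forall_inP tm /forall_inP cm /forall_inP hm.
  have m0 : m set0 = None.
    apply/eqP; apply/negPn/negP => m0.
    by have := tm set0; rewrite inE m0 complete_is_tube eqxx => /(_ isT).
  split=> //.
    move=> u v mu mv; have /forall_inP/(_ v mv) := cm u mu.
    rewrite complete_compatible //; apply: contraTneq mu => ->.
    by rewrite inE m0.
  move=> u v puv mu mv nv; have := hm u; rewrite inE => /(_ mu)/forall_inP.
  by move/(_ v); rewrite inE mv puv nv => /(_ isT)/eqP.
have ne u : u \in tubes_of m -> u != set0.
  by apply: contraTneq => ->; rewrite inE m0.
split; first (apply/and3P; split); first by rewrite inE.
- by apply/forall_inP => u mu; rewrite complete_is_tube ne.
- apply/forall_inP => u mu; apply/forall_inP => v mv.
  by rewrite complete_compatible ?ne // chm.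
apply/forall_inP => u mu; apply/forall_inP => v mv; apply/implyP => /andP[puv nv].
by rewrite !inE in mu mv; rewrite (thinm u v).
Qed.

(** * The code of a marking: the pair of its [thin_part] and its [thick_chain] *)

Definition thins m : {set {set K}} := [set u | m u == Some Thin].
Definition thicks m : {set {set K}} := [set u | m u == Some Thick].
Definition nonthicks m : {set {set K}} :=
  [set u | (m u == Some Thin) || (m u == Some Broken)].

Definition thin_part m : {set K} := cover (thins m).
Definition nonthick_part m : {set K} := cover (nonthicks m).
(** For a marked tubing, the empty set belongs to this chain exactly when every tube is thick; its
    cone in the star is then the tube made of the centre alone. *)
Definition thick_chain m : {set {set K}} := nonthick_part m |: thicks m.

Lemma subset_thin_part m u : m u = Some Thin -> u \subset thin_part m.
Proof. by move=> mu; apply: cover_sup; rewrite inE mu. Qed.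

Lemma subset_nonthick_part m u :
  m u != None -> m u != Some Thick -> u \subset nonthick_part m.
Proof.
by move=> mu1 mu2; apply: cover_sup; rewrite inE; case: (m u) mu1 mu2 => [[]|].
Qed.

(** Serves to recompute the union after a change of marking. The empty union is a separate case
    because [set0] carries no mark in a marked tubing. *)
Lemma thin_part_eq m (X : {set K}) : (forall u, m u = Some Thin -> u \subset X) ->
  X = set0 \/ m X = Some Thin -> thin_part m = X.
Proof.
move=> sub mX; apply/eqP; rewrite eqEsubset; apply/andP; split.
  by apply/bigcupsP => u; rewrite inE => /eqP/sub.
by case: mX => [->|/subset_thin_part//]; apply: sub0set.
Qed.

Lemma nonthick_part_eq m (X : {set K}) :
  (forall u, m u != None -> m u != Some Thick -> u \subset X) ->
  X = set0 \/ m X = Some Thin \/ m X = Some Broken -> nonthick_part m = X.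
Proof.
move=> sub mX; apply/eqP; rewrite eqEsubset; apply/andP; split.
  by apply/bigcupsP => u; rewrite inE => /orP[]/eqP mu; apply: sub; rewrite mu.
case: mX => [->|mX]; first exact: sub0set.
by apply: subset_nonthick_part; case: mX => ->.
Qed.

Lemma thin_nonthick_part m : thin_part m \subset nonthick_part m.
Proof. by apply: coverS; apply/subsetP => u; rewrite !inE => ->. Qed.

(** * Position of the thin, thick and broken tubes relative to the two unions *)

Section Marked.
Variable W : marked_tubing K.

Lemma mt_setT : W setT != None.
Proof. by case: W => m /= /marked_tubingP[]. Qed.

Lemma mt_set0 : W set0 = None.
Proof. by case: W => m /= /marked_tubingP[]. Qed.

Lemma mt_chain u v : W u != None -> W v != None ->
  (u \subset v) || (v \subset u).
Proof.
by case: W => m /= /marked_tubingP[_ _ ch _] mu mv; apply: ch; rewrite inE.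
Qed.

Lemma mt_thin u v : u \proper v -> W u != None -> W v != None ->
  W v != Some Thick -> W u = Some Thin.
Proof. by case: W => m /= /marked_tubingP[_ _ _]; apply. Qed.

Lemma thin_partP : thin_part W = set0 \/ W (thin_part W) = Some Thin.
Proof.
have [u v||] := @chain_cover _ (thins W).
- by rewrite !inE => /eqP mu /eqP mv; apply: mt_chain; rewrite ?mu ?mv.
- by rewrite /thin_part => ->; left; rewrite /cover big_set0.
- by rewrite inE => /eqP; right.
Qed.

Lemma nonthick_partP : nonthick_part W = set0 \/
  W (nonthick_part W) = Some Thin \/ W (nonthick_part W) = Some Broken.
Proof.
have [u v||] := @chain_cover _ (nonthicks W).
- by rewrite !inE => /orP[]/eqP mu /orP[]/eqP mv; apply: mt_chain; rewrite ?mu ?mv.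
- by rewrite /nonthick_part => ->; left; rewrite /cover big_set0.
- by rewrite inE => /orP[]/eqP mD; right; [left | right].
Qed.

(** The two sets are nested when the non-thick part is nonempty, and a thick tube strictly inside a
    non-thick one would have to be thin. *)
Lemma thick_proper u : W u = Some Thick -> nonthick_part W \proper u.
Proof.
move=> mu; case: nonthick_partP => [->|mD].
  by rewrite proper0; apply: contra_eqN mu => /eqP ->; rewrite mt_set0.
have [mD1 mD2] : W (nonthick_part W) != None /\ W (nonthick_part W) != Some Thick.
  by case: mD => ->.
have neq : u != nonthick_part W by apply: contraNneq mD2 => <-; rewrite mu.
have mu1 : W u != None by rewrite mu.
have /orP[sDu|suD] := mt_chain mD1 mu1.
  by rewrite properEneq eq_sym neq.
have puD : u \proper nonthick_part W by rewrite properEneq neq.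
by rewrite (mt_thin puD) in mu.
Qed.

Lemma broken_nonthick_part :
  nonthick_part W != thin_part W -> W (nonthick_part W) = Some Broken.
Proof.
have := thin_nonthick_part W.
case: nonthick_partP => [->|[mD|//]]; first by rewrite subset0 eq_sym => ->.
by move=> sAD; rewrite eqEsubset sAD (subset_thin_part mD).
Qed.

(** A tube strictly inside a non-thick tube is thin, so a broken tube must be the largest non-thick
    one; in particular there is at most one. It differs from [thin_part W], which is empty or marked
    thin. *)
Lemma brokenP u :
  W u = Some Broken -> u = nonthick_part W /\ nonthick_part W != thin_part W.
Proof.
move=> mu.
have sub : u \subset nonthick_part W by apply: subset_nonthick_part; rewrite mu.
have u_n0 : u != set0 by apply: contra_eqN mu => /eqP ->; rewrite mt_set0.
have eq_u : u = nonthick_part W.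
  apply/eqP; apply/negPn/negP => neq.
  have puD : u \proper nonthick_part W by rewrite properEneq neq.
  have := @mt_thin u _ puD; rewrite mu => /(_ isT).
  case: nonthick_partP => [D0|[]->]; [|by move/(_ isT isT)..].
  by move: sub; rewrite D0 subset0 (negPf u_n0).
split=> //; rewrite -eq_u; apply/eqP => eq_uA.
case: thin_partP; rewrite -eq_uA; last by rewrite mu.
by move/eqP; rewrite (negPf u_n0).
Qed.

(** Recovers the thick tubes from the chain: the non-thick part is empty or carries a non-thick
    mark, so it is the one member to discard. *)
Lemma thickP u : (W u == Some Thick) =
  (u \in thick_chain W) && (u != nonthick_part W).
Proof.
rewrite !inE; have [->/=|neq/=] := eqVneq u (nonthick_part W).
  by case: nonthick_partP => [->|[]->] //; rewrite mt_set0.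
by rewrite andbT.
Qed.

Lemma thick_chain_sup u : u \in thick_chain W -> nonthick_part W \subset u.
Proof.
rewrite !inE => /predU1P[->//|/eqP/thick_proper/proper_sub//].
Qed.

Lemma thick_chain_chain : chain (thick_chain W).
Proof.
move=> u v Cu Cv; move: (Cu) (Cv); rewrite !inE.
case/predU1P => [-> _|/eqP mu]; first by rewrite thick_chain_sup.
case/predU1P => [->|/eqP mv]; first by rewrite thick_chain_sup ?orbT.
by apply: mt_chain; rewrite ?mu ?mv.
Qed.

Lemma setT_thick_chain : setT \in thick_chain W.
Proof.
rewrite !inE; case E: (W setT) mt_setT => [[]|] // _; rewrite ?orbT ?orbF //.
all: by rewrite eq_sym -subTset subset_nonthick_part ?E.
Qed.

End Marked.

(** * Monotonicity of the code along moves *)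

Lemma move_facts W U : move W U ->
  [/\ forall w, W w = Some Thin -> U w = Some Thin,
      forall w, W w = Some Thick -> U w = Some Thick,
      forall w, W w != None -> U w != None
    & forall w, U w != None -> U w != Some Thick -> w \subset nonthick_part W].
Proof.
case/or4P.
- case/existsP => v /existsP[a /and3P[/eqP mv na /eqP ->]].
  split=> w; rewrite ffunE; case: (w =P v) => [->|_] //; rewrite ?mv //.
    by move=> _ _; apply: subset_nonthick_part; rewrite mv.
  exact: subset_nonthick_part.
- case/existsP => v /existsP[u /and4P[mv puv /eqP mu /eqP ->]].
  split=> w; rewrite ffunE; case: (w =P u) => [->|_] //; rewrite ?mu //.
    move=> _ _; apply: subset_trans (proper_sub puv) _.
    by apply: subset_nonthick_part; case/orP: mv => /eqP ->.
  exact: subset_nonthick_part.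
- case/existsP => v /existsP[u /and4P[mv puv /eqP mu /eqP ->]].
  split=> w; rewrite ffunE; case: (w =P u) => [->|_] //; rewrite ?mu //.
  exact: subset_nonthick_part.
case/existsP => v /existsP[B /and5P[/eqP mv _ /forall_inP mB _ /eqP ->]].
have mB0 w : w \in B -> W w = None by case/mB/andP => /eqP.
split=> w; rewrite !ffunE; case: (w =P v) => [->|_] //; rewrite ?mv //;
  case: ifP => // Bw; rewrite ?(mB0 _ Bw) //.
  move=> _ _; have /andP[_ /andP[pwv _]] := mB _ Bw.
  apply: subset_trans (proper_sub pwv) _.
  by apply: subset_nonthick_part; rewrite mv.
exact: subset_nonthick_part.
Qed.

(** Only the four facts common to all moves are used: thin and thick marks persist, tubes persist,
    and the non-thick tubes of [U] stay inside the old non-thick part. *)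
Lemma move_mono W U : move W U ->
  thin_part W \subset thin_part U /\ thick_chain W \subset thick_chain U.
Proof.
move=> /move_facts[thinU thickU tubeU subU]; split.
  by apply: coverS; apply/subsetP => w; rewrite !inE => /eqP/thinU ->.
apply/subsetP => w; rewrite !inE => /predU1P[->|/eqP/thickU ->]; last first.
  by rewrite eqxx orbT.
(* The old non-thick part either has become thick, or is still the whole non-thick part of [U]; in
   both cases it belongs to the new chain. *)
have [//|nthick] := altP (U (nonthick_part W) =P Some Thick); rewrite ?orbT // orbF.
rewrite eqEsubset; apply/andP; split; last first.
  by apply/bigcupsP => u; rewrite inE => /orP[]/eqP mu; apply: subU; rewrite mu.
case: (nonthick_partP W) => [->|mD]; first exact: sub0set.
by apply: subset_nonthick_part => //; apply: tubeU; case: mD => ->.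
Qed.

Lemma marked_le_mono W U : marked_le U W ->
  thin_part W \subset thin_part U /\ thick_chain W \subset thick_chain U.
Proof.
case/connectP => p; elim: p W => [|V p IH] W /=; first by move=> _ ->.
case/andP => /move_mono[sA sC] pp lastp; have [sA' sC'] := IH V pp lastp.
by split; [apply: subset_trans sA' | apply: subset_trans sC'].
Qed.

(** * Equivalence classes are determined by their codes *)

Lemma thin_in_thin_code W U : thin_in_thin W U ->
  thin_part W = thin_part U /\ thick_chain W = thick_chain U.
Proof.
case/existsP => v /existsP[u /and4P[/eqP mv puv /eqP mu /eqP eqU]].
have mUv : U v = Some Thin.
  by rewrite eqU ffunE; case: (v =P u) => // ->; rewrite mv.
(* The added tube lies inside the thin tube [v], hence inside any set containing [v]: neither union
   can grow. *)
have su (X : {set K}) : v \subset X -> u \subset X by apply: subset_trans (proper_sub puv).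
have eqA : thin_part W = thin_part U.
  apply/esym/thin_part_eq => [w|].
    rewrite eqU ffunE; case: (w =P u) => [-> _|_ /subset_thin_part//].
    by apply/su/subset_thin_part.
  case: (thin_partP W) => [->|mA]; [by left | right].
  by rewrite eqU ffunE mA; case: (_ =P u).
have eqD : nonthick_part W = nonthick_part U.
  apply/esym/nonthick_part_eq => [w|].
    rewrite eqU ffunE; case: (w =P u) => [-> _ _|_]; last exact: subset_nonthick_part.
    by apply/su/subset_nonthick_part; rewrite mv.
  case: (nonthick_partP W) => [->|mD]; [by left | right].
  by rewrite eqU ffunE; case: (_ =P u) => //; left.
split=> //; apply/setP => w; rewrite !inE eqD; congr (_ || _).
by rewrite eqU ffunE; case: (w =P u) => // ->; rewrite mu.
Qed.

Lemma compo_equiv_code W U : compo_equiv W U ->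
  thin_part W = thin_part U /\ thick_chain W = thick_chain U.
Proof.
case/connectP => p; elim: p W => [|V p IH] W /=; first by move=> _ ->.
case/andP => e pp lastp; have [<- <-] := IH V pp lastp.
by case/orP: e => /thin_in_thin_code[-> ->].
Qed.

(** The non-thick part is the least member of the chain, so the chain determines it. *)
Lemma nonthick_part_code U V :
  thick_chain U = thick_chain V -> nonthick_part U = nonthick_part V.
Proof.
move=> eqC; have CD W : nonthick_part W \in thick_chain W by apply: setU11.
apply/eqP; rewrite eqEsubset; apply/andP; split; apply: thick_chain_sup.
  by rewrite eqC CD.
by rewrite -eqC CD.
Qed.

(** As the tubes form a chain, this says that no thin tube lies inside another: these are the
    canonical representatives of the classes. *)
Definition reduced U := forall u, U u = Some Thin -> u = thin_part U.

(** All marks can be read off the code: thick tubes through [thickP], the broken tube as the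
    non-thick part when it differs from the thin part, and the only thin tube as the thin part when
    that is nonempty. *)
Lemma reduced_code_inj U V : reduced U -> reduced V ->
  thin_part U = thin_part V -> thick_chain U = thick_chain V -> U = V.
Proof.
move=> redU redV eqA eqC; have eqD := nonthick_part_code eqC.
apply/val_inj/ffunP => w /=.
have thinE (X Y : marked_tubing K) : reduced X -> thin_part X = thin_part Y ->
    X w = Some Thin -> Y w = Some Thin.
  move=> redX eqXY Xw; have w0 : w != set0.
    by apply: contra_eqN Xw => /eqP ->; rewrite mt_set0.
  by case: (thin_partP Y); rewrite -eqXY -(redX _ Xw) // => /eqP; rewrite (negPf w0).
have thickE : (U w == Some Thick) = (V w == Some Thick) by rewrite !thickP eqC eqD.
have brokenE (X Y : marked_tubing K) : nonthick_part X = nonthick_part Y ->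
    thin_part X = thin_part Y -> X w = Some Broken -> Y w = Some Broken.
  move=> eqXY eqXY' /brokenP[-> ]; rewrite eqXY eqXY'.
  exact: broken_nonthick_part.
case EU: (U w) => [[]|]; case EV: (V w) => [[]|] //; move: thickE;
  rewrite EU EV // => _.
all: first
  [ by rewrite -EV (thinE _ _ redU eqA EU) | by rewrite -EU (thinE _ _ redV (esym eqA) EV)
  | by rewrite -EV (brokenE _ _ eqD eqA EU)
  | by rewrite -EU (brokenE _ _ (esym eqD) (esym eqA) EV) ].
Qed.

(** Unmarking [u] keeps the marking valid, and the largest thin tube remains as the thin tube inside
    which [u] can be added back. The cardinality bound drives the reduction to a canonical
    representative. *)
Lemma remove_thin U u : U u = Some Thin -> u != thin_part U ->
  exists2 V, thin_in_thin V U & #|thins V| < #|thins U|.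
Proof.
move=> Uu neq.
have puA : u \proper thin_part U by rewrite properEneq neq subset_thin_part.
have UA : U (thin_part U) = Some Thin.
  by case: (thin_partP U) => // A0; move: puA; rewrite A0 properE sub0set andbF.
pose m : {ffun {set K} -> option mark} := [ffun w => if w == u then None else U w].
have mE w : m w != None -> w != u /\ m w = U w.
  by rewrite /m ffunE; case: (w =P u).
have mtm : is_marked_tubing m.
  apply/marked_tubingP; split.
  - rewrite ffunE; case: (_ =P u) => [eTu|_]; last exact: mt_setT.
    by move: puA; rewrite -eTu properE subsetT andbF.
  - by rewrite ffunE mt_set0; case: ifP.
  - move=> v w; rewrite !inE => mv mw; apply: (mt_chain (W := U)).
      by have [_ <-] := mE _ mv.
    by have [_ <-] := mE _ mw.
  - move=> v w pvw /[dup] /mE[_ ->] mv /[dup] /mE[_ ->] mw.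
    exact: mt_thin.
exists (MarkedTubing mtm).
  apply/existsP; exists (thin_part U); apply/existsP; exists u.
  have nA : (thin_part U == u) = false by rewrite eq_sym; apply: negbTE.
  rewrite /= !ffunE nA UA puA !eqxx /=.
  by apply/eqP/ffunP => w; rewrite !ffunE; case: (w =P u) => // ->.
apply: proper_card; apply/properP; split.
  by apply/subsetP => w; rewrite !inE ffunE; case: (w =P u).
by exists u; rewrite !inE ?ffunE ?Uu ?eqxx.
Qed.

Lemma compo_equiv_reduced U : exists2 V, compo_equiv U V & reduced V.
Proof.
have [k] := ubnP #|thins U|; elim: k U => // k IH U leUk.
have [/forall_inP red|] := boolP [forall u in thins U, u == thin_part U].
  exists U; first exact: compo_equiv_refl.
  by move=> u Uu; apply/eqP/red; rewrite inE Uu.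
rewrite negb_forall => /existsP[u]; rewrite negb_imply inE => /andP[/eqP Uu neq].
have [V VU ltV] := remove_thin Uu neq.
have [|X VX redX] := IH V; first exact: leq_trans ltV _.
exists X => //; apply: compo_equiv_trans VX; apply: connect1.
by rewrite /= VU orbT.
Qed.

(** Reduction preserves the code, and the two reduced representatives have the same code, so they
    coincide. *)
Lemma code_compo_equiv U V : thin_part U = thin_part V ->
  thick_chain U = thick_chain V -> compo_equiv U V.
Proof.
move=> eqA eqC; have [U' UU' redU] := compo_equiv_reduced U.
have [V' VV' redV] := compo_equiv_reduced V.
have [eqA1 eqC1] := compo_equiv_code UU'.
have [eqA2 eqC2] := compo_equiv_code VV'.
have eqUV : U' = V' by apply: reduced_code_inj; rewrite -?eqA1 -?eqA2 -?eqC1 -?eqC2.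
by apply: compo_equiv_trans UU' _; rewrite eqUV compo_equiv_sym.
Qed.

(** * Reaching a prescribed larger code $(A, C)$ by moves *)

Section Step.
Variables (A : {set K}) (C : {set {set K}}).
Hypothesis chC : chain C.
Hypothesis AC : forall S, S \in C -> A \subset S.

(* If [A] is the whole non-thick part, the broken tube is resolved to thin,
   otherwise [A] is added as a thin tube: both amount to [set_mark V A Thin]. *)
Lemma step_thin V : thick_chain V \subset C -> thin_part V \proper A ->
  exists2 U, move V U & thin_part U = A /\ thick_chain U = thick_chain V.
Proof.
move=> sC pA; have sAD : A \subset nonthick_part V.
  by apply/AC/(subsetP sC); rewrite setU11.
have A0 : A != set0 by apply: contraTneq pA => ->; rewrite properE sub0set andbF.
have nDA : nonthick_part V != thin_part V.
  by apply: contraTneq pA => <-; rewrite properE sAD andbF.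
have VD := broken_nonthick_part nDA.
have thinV u : V u = Some Thin -> u \proper A.
  by move=> /subset_thin_part sA; apply: sub_proper_trans pA.
pose m := set_mark V A Thin.
have mA : m A = Some Thin by rewrite ffunE eqxx.
have mN w : w != A -> m w = V w by rewrite ffunE => /negPf ->.
have VA : A != nonthick_part V -> V A = None.
  case E: (V A) => [[]|] // neq.
  - by have := thinV _ E; rewrite properxx.
  - by have := thick_proper E; rewrite properE sAD andbF.
  - by have [/eqP] := brokenP E; rewrite (negPf neq).
(* Thin tubes lie strictly inside [A], thick tubes strictly contain the non-thick part and hence
   [A], and the broken tube is the non-thick part itself. *)
have chA w : V w != None ->
    [\/ w = A, w \proper A /\ V w = Some Thin | A \proper w].
  case E: (V w) => [[]|] // _.
  - by apply: Or32; split=> //; apply: thinV.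
  - by apply: Or33; apply: sub_proper_trans (thick_proper E).
  - have [-> _] := brokenP E.
    have [eAD|neAD] := eqVneq A (nonthick_part V); first by apply: Or31.
    by apply: Or33; rewrite properEneq neAD.
have mtm : is_marked_tubing m.
  apply/marked_tubingP; split.
  - by rewrite ffunE; case: (_ =P A) => // _; apply: mt_setT.
  - by rewrite mN ?mt_set0 // eq_sym.
  - move=> v w; rewrite !inE.
    have [->|nv] := eqVneq v A.
      move=> _; have [->|nw] := eqVneq w A; first by rewrite subxx.
      by rewrite mN // => /chA[eq|[/proper_sub ->]|/proper_sub ->]; rewrite ?orbT // eq subxx.
    have [->|nw] := eqVneq w A.
      by rewrite mN // => /chA[eq|[/proper_sub ->]|/proper_sub ->]; rewrite ?orbT // eq subxx.
    by rewrite !mN //; apply: mt_chain.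
  - move=> v w pvw.
    have [->|nv] := eqVneq v A; first by rewrite mA.
    rewrite mN //; have [ew|nw] := eqVneq w A.
      move=> mv _ _; case: (chA _ mv) => [/eqP||pAv]; first by rewrite (negPf nv).
        by case.
      by have := proper_trans pAv pvw; rewrite ew properxx.
    by rewrite mN //; apply: mt_thin.
exists (MarkedTubing mtm).
  have [eAD|neAD] := eqVneq A (nonthick_part V).
    apply/or4P/Or41/existsP; exists A; apply/existsP; exists Thin.
    by rewrite eAD VD !eqxx /= /m eAD.
  apply/or4P/Or42/existsP; exists (nonthick_part V); apply/existsP; exists A.
  by rewrite VD VA // properEneq neAD sAD !eqxx orbT.
split.
  apply: thin_part_eq => [u|]; last by right.
  have [->|nu] := eqVneq u A; first by rewrite subxx.
  by rewrite /= mN // => /thinV/proper_sub.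
have eqD : nonthick_part m = nonthick_part V.
  apply: nonthick_part_eq => [u|].
    have [->//|nu] := eqVneq u A.
    by rewrite mN //; apply: subset_nonthick_part.
  right; have [->|nu] := eqVneq (nonthick_part V) A; first by left.
  by rewrite mN //; right.
apply/setP => w; rewrite !inE /= eqD.
have [->|nu] := eqVneq w A; last by rewrite mN.
rewrite mA; have [//|neq] := eqVneq A (nonthick_part V).
by rewrite VA.
Qed.

(** Since [S] lies above the non-thick part, marking it thick leaves both unions unchanged and adds
    just [S] to the chain. *)
Lemma step_thick V S : thick_chain V \subset C -> S \in C ->
    S \notin thick_chain V -> nonthick_part V \proper S ->
  exists2 U, move V U &
    thin_part U = thin_part V /\ thick_chain U = S |: thick_chain V.
Proof.
move=> sC CS VS pDS; pose m := set_mark V S Thick.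
have mS : m S = Some Thick by rewrite ffunE eqxx.
have mN w : w != S -> m w = V w by rewrite ffunE => /negPf ->.
have VS0 : V S = None.
  apply/eqP; apply/negPn/negP => nS; move: VS; rewrite !inE negb_or => /andP[_ nt].
  by have := subset_nonthick_part nS nt; rewrite (negPf (proper_subn pDS)).
have chS w : V w != None -> (w \subset S) || (S \subset w).
  move=> Vw; have [Vw1|Vw1] := eqVneq (V w) (Some Thick).
    by apply: chC CS; apply: (subsetP sC); rewrite !inE Vw1 eqxx orbT.
  by rewrite (subset_trans (subset_nonthick_part Vw Vw1) (proper_sub pDS)).
have mtm : is_marked_tubing m.
  apply/marked_tubingP; split.
  - by rewrite ffunE; case: (_ =P S) => // _; apply: mt_setT.
  - rewrite mN ?mt_set0 //; apply: contraTneq pDS => <-.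
    by rewrite properE sub0set andbF.
  - move=> v w; rewrite !inE.
    have [->|nv] := eqVneq v S.
      move=> _; have [->|nw] := eqVneq w S; first by rewrite subxx.
      by rewrite mN // orbC; apply: chS.
    have [->|nw] := eqVneq w S; first by rewrite mN // => Vv _; apply: chS.
    by rewrite !mN //; apply: mt_chain.
  - move=> v w pvw; have [->|nw] := eqVneq w S; first by rewrite mS eqxx.
    rewrite [m w]mN //; have [ev|nv] := eqVneq v S; last by rewrite mN //; apply: mt_thin.
    move=> _ Vw Vw1; have sw := subset_nonthick_part Vw Vw1.
    have := proper_sub_trans pvw sw.
    by rewrite ev properE (negPf (proper_subn pDS)).
(* The non-thick part is strictly inside [S], so it is not the universal tube; the latter is
   therefore thick and can host the new thick tube. *)
have TV : V setT = Some Thick.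
  apply/eqP; rewrite thickP setT_thick_chain.
  by apply: contraTneq pDS => <-; rewrite properE subsetT andbF.
exists (MarkedTubing mtm).
  apply/or4P/Or43/existsP; exists setT; apply/existsP; exists S.
  rewrite TV VS0 !eqxx properEneq subsetT !andbT /=.
  by apply/eqP => eST; rewrite eST TV in VS0.
have eqD : nonthick_part m = nonthick_part V.
  apply: nonthick_part_eq => [u|].
    have [->|nu] := eqVneq u S; first by rewrite mS.
    by rewrite mN //; apply: subset_nonthick_part.
  case: (nonthick_partP V) => [->|VD]; [by left | right].
  by rewrite mN //; apply: contraTneq pDS => ->; rewrite properxx.
split.
  apply: thin_part_eq => [u|] /=.
    have [->|nu] := eqVneq u S; first by rewrite mS.
    by rewrite mN //; apply: subset_thin_part.
  case: (thin_partP V) => [->|VA]; [by left | right].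
  by rewrite mN //; apply: contra_eqN VA => /eqP ->; rewrite VS0.
apply/setP => w; rewrite !inE /= eqD.
have [->|nu] := eqVneq w S; last by rewrite mN.
by rewrite mS eqxx orbT.
Qed.

(* The broken tube becomes thick, and [S] is added as a broken tube unless it is
   empty or already the largest thin tube, i.e. unless [S = A]. *)
Lemma step_below V S : thin_part V = A -> thick_chain V \subset C -> S \in C ->
    S \proper nonthick_part V ->
  exists2 U, move V U &
    thin_part U = thin_part V /\ thick_chain U = S |: thick_chain V.
Proof.
move=> VA sC CS pSD; have sAS : A \subset S by apply: AC.
have nAD : nonthick_part V != thin_part V.
  by apply: contraTneq pSD => ->; rewrite VA properE sAS andbF.
have VD := broken_nonthick_part nAD.
set D := nonthick_part V in pSD nAD VD.
have nSD : S != D by apply: contraTneq pSD => ->; rewrite properxx.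
pose m := set_mark (if S == A then marks V else set_marks V [set S] Broken) D Thick.
have mD : m D = Some Thick by rewrite ffunE eqxx.
have mS : S != A -> m S = Some Broken.
  by move=> /negPf nSA; rewrite ffunE (negPf nSD) nSA ffunE inE eqxx.
have mN w : w != D -> (w != S) || (S == A) -> m w = V w.
  move=> /negPf nw; rewrite ffunE nw.
  have [->|] := eqVneq S A; rewrite ?eqxx ?orbF //= => nSA /negPf nS.
  by rewrite ffunE inE nS.
have thinS w : V w = Some Thin -> w \subset S.
  by move=> /subset_thin_part; rewrite VA => sw; apply: subset_trans sAS.
have tubeV w : V w != None -> V w = Some Thin \/ D \subset w.
  case E: (V w) => [[]|] // _; first by left.
    by right; apply: proper_sub; apply: thick_proper.
  by right; have [->] := brokenP E.
have VS0 : S != A -> V S = None.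
  move=> nSA; case E: (V S) => [[]|] //.
  - by have := subset_thin_part E; rewrite VA => sSA; rewrite eqEsubset sSA sAS in nSA.
  - by have := thick_proper E; rewrite properE (negPf (proper_subn pSD)).
  - by have [/eqP] := brokenP E; rewrite (negPf nSD).
have chS w : V w != None -> (w \subset S) || (S \subset w).
  case/tubeV => [/thinS ->//|sDw].
  by rewrite (subset_trans (proper_sub pSD) sDw) orbT.
have mP w : m w != None -> V w != None \/ w = S.
  have [->|nw] := eqVneq w D; first by rewrite VD; left.
  have [->|nS] := eqVneq w S; first by right.
  by rewrite mN ?nS //; left.
have thinm w : m w != None -> m w != Some Thick -> w = S \/ V w = Some Thin.
  have [->|nw] := eqVneq w D; first by rewrite mD.
  have [->|nS] := eqVneq w S; first by left.
  rewrite mN ?nS // => Vw nt; right; case E: (V w) Vw nt => [[]|] // _ _.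
  by have [/eqP] := brokenP E; rewrite (negPf nw).
have mtm : is_marked_tubing m.
  apply/marked_tubingP; split.
  - rewrite ffunE; case: (_ =P D) => // _; case: (S =P A) => _; first exact: mt_setT.
    by rewrite ffunE inE; case: (_ =P S) => // _; apply: mt_setT.
  - rewrite mN ?mt_set0 //.
      by apply: contra_eqN VD => /eqP <-; rewrite mt_set0.
    have [_|nSA] := eqVneq S A; rewrite ?orbT ?orbF //; apply: contraNneq nSA => S0.
    by rewrite -S0 eq_sym -subset0 S0.
  - move=> v w; rewrite !inE => /mP[Vv|->] /mP[Vw|->]; first exact: mt_chain Vv Vw.
    + exact: chS.
    + by rewrite orbC; apply: chS.
    + by rewrite subxx.
  - move=> v w pvw mv mw nt.
    (* All non-thick tubes of [m] lie inside [S], so [v] lies strictly inside [S] and hence strictly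
       inside [D]; an old tube that does not contain [D] is thin. *)
    have swS : w \subset S by case: (thinm w mw nt) => [->//|/thinS].
    have pvS : v \proper S := proper_sub_trans pvw swS.
    have nvD : v != D.
      by apply: contraTneq (proper_trans pvS pSD) => ->; rewrite properxx.
    have nvS : v != S by apply: contraTneq pvS => ->; rewrite properxx.
    rewrite mN ?nvS // in mv *.
    have [//|sDv] := tubeV v mv.
    have := sub_proper_trans sDv (proper_trans pvS pSD).
    by rewrite properxx.
exists (MarkedTubing mtm).
  have [eSA|nSA] := eqVneq S A.
    apply/or4P/Or41/existsP; exists D; apply/existsP; exists Thick.
    by rewrite VD !eqxx /= /m eSA eqxx.
  apply/or4P/Or44/existsP; exists D; apply/existsP; exists [set S].
  rewrite VD /= /m (negPf nSA) !eqxx andbT; apply/and3P; split.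
  - by apply/set0Pn; exists S; rewrite inE.
  - apply/forall_inP => u; rewrite inE => /eqP ->; rewrite VS0 // /closely_nested pSD /=.
    apply/forall_inP => w; rewrite inE => /tubeV[/thinS sw|sDw].
      by rewrite properE sw andbF.
    by rewrite negb_and orbC properE sDw andbF.
  - apply/forall_inP => u; rewrite inE => /eqP ->.
    apply/forall_inP => u'; rewrite inE => /eqP ->.
    by rewrite /compatible subxx.
have eqA : thin_part m = thin_part V.
  apply: thin_part_eq => [u mu|].
    have := thinm u; rewrite mu => /(_ isT isT)[uS|]; last exact: subset_thin_part.
    have [eSA|nSA] := eqVneq S A; first by rewrite uS eSA VA.
    by move: mu; rewrite uS mS.
  case: (thin_partP V) => [->|VA']; [by left | right].
  rewrite mN //; first by rewrite eq_sym.
  by rewrite VA [A == S]eq_sym; case: (S == A).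
(* The old non-thick part [D] stays in the chain as a thick tube, while [S] enters it as the new
   non-thick part. *)
have eqD : nonthick_part m = S.
  apply: nonthick_part_eq => [u mu nt|].
    by have [->|/thinS] := thinm u mu nt.
  have [eSA|nSA] := eqVneq S A; last by right; right; rewrite mS.
  rewrite mN ?eSA ?eqxx ?orbT -?eSA //.
  by case: (thin_partP V); rewrite VA -eSA => ->; [left | right; left].
split=> //; apply/setP => w; rewrite !inE /= eqD -/D.
have [->//|nwS/=] := eqVneq w S.
have [->|nwD/=] := eqVneq w D; first by rewrite mD.
by rewrite mN ?nwS.
Qed.

(** The thin part is enlarged to [A] first, because [step_below] requires it; the members of [C] are
    then added one at a time, by induction on the number still missing. *)
Lemma path_to_code V : setT \in C -> thin_part V \subset A -> thick_chain V \subset C ->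
  exists2 U, connect (@move K) V U & thin_part U = A /\ thick_chain U = C.
Proof.
move=> CT sA sC.
have [V1 VV1 [VA VC]] : exists2 U, connect (@move K) V U &
    thin_part U = A /\ thick_chain U = thick_chain V.
  have [eqA|neqA] := eqVneq (thin_part V) A; first by exists V.
  have [|U VU eqU] := step_thin sC; first by rewrite properEneq neqA.
  by exists U => //; apply: connect1.
rewrite -VC in sC; suff [U V1U eqU] : exists2 U, connect (@move K) V1 U &
    thin_part U = A /\ thick_chain U = C.
  by exists U => //; apply: connect_trans V1U.
have [k] := ubnP #|C :\: thick_chain V1|.
elim: k V1 VA sC {VV1 VC} => // k IH W WA sC leWk.
have [eqC|/set0Pn[S]] := eqVneq (C :\: thick_chain W) set0.
  exists W => //; split=> //; apply/eqP.
  by rewrite eqEsubset sC -setD_eq0 eqC eqxx.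
rewrite inE => /andP[nWS CS].
have [U WU [UA UC]] : exists2 U, move W U &
    thin_part U = thin_part W /\ thick_chain U = S |: thick_chain W.
  (* Both sets belong to the chain [C], so the missing [S] lies strictly below or strictly above the
     non-thick part, which selects the move. *)
  have CD : nonthick_part W \in C by apply: (subsetP sC); apply: setU11.
  have neq : S != nonthick_part W.
    by apply: contraNneq nWS => ->; apply: setU11.
  case/orP: (chC CS CD) => sub.
    by apply: step_below; rewrite // properEneq neq.
  by apply: step_thick; rewrite // properEneq eq_sym neq.
have [|||X UX eqX] := IH U.
- by rewrite UA.
- by rewrite UC subUset sub1set CS.
- rewrite ltnS in leWk; apply: leq_trans leWk; apply: proper_card.
  rewrite UC setDUr; apply/properP; split; first exact: subsetIr.
  by exists S; rewrite ?in_setI in_setD ?set11 // nWS.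
by exists X => //; apply: connect_trans UX; apply: connect1.
Qed.

(** The starting point is the marking whose only tube is the universal one, marked broken: its code,
    the empty set with the chain reduced to [setT], is contained in every admissible code. *)
Lemma exists_code : setT != set0 :> {set K} -> setT \in C ->
  exists U, thin_part U = A /\ thick_chain U = C.
Proof.
move=> T0 CT.
pose m : {ffun {set K} -> option mark} :=
  [ffun w => if w == setT then Some Broken else None].
have mT : m setT = Some Broken by rewrite ffunE eqxx.
have mP w : m w != None -> w = setT by rewrite ffunE; case: (w =P setT).
have mtm : is_marked_tubing m.
  apply/marked_tubingP; split.
  - by rewrite mT.
  - by rewrite ffunE eq_sym (negPf T0).
  - by move=> v w; rewrite !inE => /mP-> /mP->; rewrite subxx.
  - by move=> v w pvw /mP ev /mP ew; move: pvw; rewrite ev ew properxx.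
have [|||U _ eqU] := @path_to_code (MarkedTubing mtm) => //; last by exists U.
  by apply/bigcupsP => u; rewrite inE ffunE; case: ifP.
rewrite /thick_chain (@nonthick_part_eq _ setT) => [|u _ _|].
- apply/subsetP => w; rewrite !inE => /predU1P[->//|].
  by rewrite ffunE; case: ifP.
- exact: subsetT.
- by right; right.
Qed.

End Step.
End Complete.

(** * Tubings of the star graph as pairs of a set of leaves and a chain *)

Section Star.
Variable n : nat.
Local Notation K := (complete_graph n).
Local Notation St := (star_graph n).
Implicit Types (A S : {set K}) (C : {set {set K}}) (X : {set St}).

Definition leaf (i : K) : St := lift ord0 i.

Definition cone S : {set St} := (ord0 : St) |: [set leaf i | i in S].

Definition star_code A C : {set {set St}} :=
  [set cone S | S in C] :|: [set [set leaf i] | i in A].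

Lemma leaf_inj : injective leaf.
Proof. exact: lift_inj. Qed.

Lemma leaf_neq0 i : (leaf i == ord0) = false.
Proof. by apply: negbTE; rewrite eq_sym neq_lift. Qed.

Lemma vertexP (x : St) : x = ord0 \/ exists i, x = leaf i.
Proof.
by case: (unliftP (ord0 : 'I_n.+1) x) => [i|] ->; [right; exists i | left].
Qed.

Lemma cone0 S : (ord0 : St) \in cone S.
Proof. exact: setU11. Qed.

Lemma leaf_cone i S : (leaf i \in cone S) = (i \in S).
Proof. by rewrite in_setU1 leaf_neq0 mem_imset //; apply: leaf_inj. Qed.

Lemma cone_sub S S' : (cone S \subset cone S') = (S \subset S').
Proof.
apply/subsetP/subsetP => sub => [i|x]; first by rewrite -!leaf_cone; apply: sub.
by have [->|[i ->]] := vertexP x; rewrite ?cone0 // !leaf_cone; apply: sub.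
Qed.

Lemma cone_inj : injective cone.
Proof.
by move=> S S' eq_c; apply/eqP; rewrite eqEsubset -!cone_sub eq_c subxx.
Qed.

Lemma cone_surj X : (ord0 : St) \in X -> X = cone [set i | leaf i \in X].
Proof.
move=> X0; apply/setP => x; have [->|[i ->]] := vertexP x; first by rewrite cone0.
by rewrite leaf_cone inE.
Qed.

Lemma coneT : cone setT = setT.
Proof.
apply/setP => x; have [->|[i ->]] := vertexP x; first by rewrite cone0 inE.
by rewrite leaf_cone !inE.
Qed.

(** Every edge of the star meets the centre, so a connected set avoiding the centre has a single
    node, whereas a set containing it is connected through it. *)
Lemma star_is_tubeP X :
  reflect ((ord0 : St) \in X \/ exists i, X = [set leaf i]) (is_tube X).
Proof.
apply: (iffP andP) => [[/set0Pn[x Xx] /forall_inP conX]|].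
  have [X0|nX0] := boolP ((ord0 : St) \in X); [by left | right].
  have [x0|[i xi]] := vertexP x; first by rewrite x0 (negPf nX0) in Xx.
  exists i; rewrite -xi; apply/eqP; rewrite eqEsubset sub1set Xx andbT.
  apply/subsetP => y Xy; rewrite inE.
  (* A nonempty path inside [X] would begin with an edge, one end of which is the centre, although
     the centre is not in [X]. *)
  have /forall_inP/(_ y Xy)/connectP[[|z p] /=] := conX x Xx; first by move=> _ ->.
  rewrite /star_adj => /andP[/and3P[_ Xz /andP[_ /orP[]/eqP e]]] _ _.
    by rewrite -e Xx in nX0.
  by rewrite -e Xz in nX0.
case=> [X0|[i ->]]; last first.
  split; first by apply/set0Pn; exists (leaf i); rewrite inE.
  apply/forall_inP => x; rewrite inE => /eqP ->.
  by apply/forall_inP => y; rewrite inE => /eqP ->; apply: connect0.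
split; first by apply/set0Pn; exists (ord0 : St).
have symc : symmetric (connect (induced_adj X)).
  apply: sym_connect_sym => a b.
  by rewrite /induced_adj /= star_adj_sym andbCA.
have c0 x : x \in X -> connect (induced_adj X) ord0 x.
  move=> Xx; have [->|[i xi]] := vertexP x; first exact: connect0.
  apply: connect1; rewrite /induced_adj /= X0 Xx /star_adj eqxx andbT /=.
  by rewrite eq_sym xi leaf_neq0.
apply/forall_inP => x Xx; apply/forall_inP => y Xy.
by apply: connect_trans (c0 y Xy); rewrite symc c0.
Qed.

Lemma leaf_cone_neq i S : [set leaf i] != cone S.
Proof.
by apply/eqP => /setP/(_ ord0); rewrite cone0 inE eq_sym leaf_neq0.
Qed.

Lemma cone_code S A C : (cone S \in star_code A C) = (S \in C).
Proof.
rewrite inE mem_imset; last exact: cone_inj.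
case: imsetP => [[i _ eqi]|_]; last by rewrite orbF.
by have := leaf_cone_neq i S; rewrite eqi eqxx.
Qed.

Lemma leaf_code i A C : ([set leaf i] \in star_code A C) = (i \in A).
Proof.
rewrite inE (mem_imset _ (f := fun i => [set leaf i])); last first.
  by move=> j k /set1_inj/leaf_inj.
case: imsetP => //= -[S _ eqi].
by have := leaf_cone_neq i S; rewrite eqi eqxx.
Qed.

(** Cones contain the centre and leaf singletons do not, so the two kinds of tubes never coincide
    and the inclusion splits. *)
Lemma star_codeS A C A' C' :
  (star_code A C \subset star_code A' C') = (A \subset A') && (C \subset C').
Proof.
apply/idP/andP => [/subsetP sub|[sA sC]]; last by apply: setUSS; apply: imsetS.
split; apply/subsetP => i; first by rewrite -(leaf_code i A C) => /sub; rewrite leaf_code.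
by rewrite -(cone_code i A C) => /sub; rewrite cone_code.
Qed.

(** Cones are nested because [C] is a chain, a leaf of [A] lies in each cone, and two distinct
    leaves are disjoint with a union that is not a tube. *)
Lemma star_code_tubing A C : setT \in C -> chain C ->
  (forall S, S \in C -> A \subset S) -> is_tubing (star_code A C).
Proof.
move=> CT chC AC; apply/and3P; split.
- by rewrite -coneT cone_code.
- apply/forall_inP => X /setUP[]/imsetP[S _ ->]; apply/star_is_tubeP.
    by left; apply: cone0.
  by right; exists S.
- have leafS i S : i \in A -> S \in C -> [set leaf i] \subset cone S.
    by move=> Ai CS; rewrite sub1set leaf_cone (subsetP (AC S CS)).
  apply/forall_inP => X /setUP[]/imsetP[S CS ->]; apply/forall_inP => Y;
    case/setUP => /imsetP[S' CS' ->]; rewrite /compatible.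
  + by rewrite !cone_sub orbA chC.
  + by rewrite leafS // orbT.
  + by rewrite leafS.
  + rewrite !sub1set !inE disjoints1 inE; have [//|neq/=] := eqVneq (leaf S) (leaf S').
    apply/star_is_tubeP => -[|[i]].
      by rewrite !inE !(eq_sym ord0) !leaf_neq0.
    move/setP => eqi; move: (eqi (leaf S)) (eqi (leaf S')) neq.
    by rewrite !inE !eqxx orbT => /esym/eqP-> /esym/eqP->; rewrite eqxx.
Qed.

(** Two cones share the centre, so compatibility forces nesting. A leaf together with a cone always
    forms a tube, so compatibility forces the leaf into the cone. *)
Lemma tubing_star_code (T : {set {set St}}) : is_tubing T ->
  exists A C, [/\ setT \in C, chain C, forall S, S \in C -> A \subset S
    & star_code A C = T].
Proof.
case/and3P => TT /forall_inP tubeT /forall_inP comT.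
have comp X Y : X \in T -> Y \in T -> compatible X Y.
  by move=> TX TY; have /forall_inP := comT X TX; apply.
exists [set i | [set leaf i] \in T], [set S | cone S \in T]; split.
- by rewrite inE coneT.
- move=> S S'; rewrite !inE => TS TS'.
  have := comp _ _ TS TS'; rewrite /compatible !cone_sub orbA => /orP[//|].
  by case/andP => /pred0P/(_ ord0) /=; rewrite !cone0.
- move=> S; rewrite inE => TS; apply/subsetP => i; rewrite inE => Ti.
  have /or3P[|/subsetP/(_ _ (cone0 S))|/andP[_]] := comp _ _ Ti TS.
  + by rewrite sub1set leaf_cone.
  + by rewrite inE eq_sym leaf_neq0.
  + by case/star_is_tubeP; left; rewrite in_setU cone0 orbT.
apply/setP => X; apply/setUP/idP => [[]/imsetP[S]|TX].
- by rewrite inE => TS ->.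
- by rewrite inE => TS ->.
case/star_is_tubeP: (tubeT X TX) => [/cone_surj eqX|[i eqX]]; [left | right].
  by rewrite eqX imset_f // inE -eqX.
by rewrite eqX; apply/imsetP; exists i => //; rewrite inE -eqX.
Qed.

(** * The correspondence between marked tubings of $K_n$ and tubings of $St_n$ *)

Lemma marked_code_tubing (U : marked_tubing K) :
  is_tubing (star_code (thin_part U) (thick_chain U)).
Proof.
apply: star_code_tubing.
- exact: setT_thick_chain.
- exact: thick_chain_chain.
- move=> S /thick_chain_sup; apply: subset_trans; exact: thin_nonthick_part.
Qed.

Definition marked_code (U : marked_tubing K) : tubing St :=
  exist (fun T : {set {set St}} => is_tubing T) _ (marked_code_tubing U).

Lemma marked_codeE U V : (marked_code U = marked_code V) <-> compo_equiv U V.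
Proof.
split=> [/(congr1 sval)/= eqc|/compo_equiv_code[eqA eqC]]; last first.
  by apply: val_inj; rewrite /= eqA eqC.
have /andP[sA sC] : (thin_part U \subset thin_part V) &&
    (thick_chain U \subset thick_chain V) by rewrite -star_codeS eqc.
have /andP[sA' sC'] : (thin_part V \subset thin_part U) &&
    (thick_chain V \subset thick_chain U) by rewrite -star_codeS eqc.
by apply: code_compo_equiv; apply/eqP; rewrite eqEsubset ?sA ?sC.
Qed.

Lemma marked_code_surj (T : tubing St) : 0 < n -> exists U, marked_code U = T.
Proof.
move=> n_gt0; case: T => T tubT.
have [A [C [CT chC AC eqT]]] := tubing_star_code tubT.
have [|U [UA UC]] := exists_code chC AC _ CT; last first.
  by exists U; apply: val_inj; rewrite /= UA UC.
by apply/set0Pn; exists (Ordinal n_gt0); rewrite inE.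
Qed.

(** From right to left this is monotonicity along moves. Conversely, the code of [U] serves as the
    target of a path of moves starting at [V]; its endpoint has the code of [U], hence is equivalent
    to [U]. *)
Lemma marked_code_le (U V : marked_tubing K) :
  tubing_le (marked_code U) (marked_code V) <->
  exists2 U' : marked_tubing K, compo_equiv U U' & marked_le U' V.
Proof.
rewrite /tubing_le /= star_codeS; split=> [/andP[sA sC]|[U' eqU leU]]; last first.
  have [-> ->] := compo_equiv_code eqU; apply/andP.
  exact: marked_le_mono.
have [|U' VU' [eqA eqC]] := path_to_code (@thick_chain_chain n U) _ (setT_thick_chain U) sA sC.
  by move=> S /thick_chain_sup; apply: subset_trans; apply: thin_nonthick_part.
by exists U' => //; apply: code_compo_equiv.
Qed.

End Star.

Theorem theorem4p13 (n : nat) (hn : 1 <= n) :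
  poset_isomorphic (@compo_le (complete_graph n)) (@tubing_le (star_graph n)).
Proof.
pose Q := {eq_quot (compo_equiv_rel (complete_graph n))}%qT.
have piE (U V : marked_tubing (complete_graph n)) :
    (\pi_Q U == \pi_Q V)%qT = compo_equiv U V.
  exact/eqmodE.
(* Equivalent markings have equal codes, so the choice of representative made by [repr] does not
   affect the value. *)
exists (fun x => marked_code (repr (x : Q))); split.
  have code_ex (T : tubing (star_graph n)) : exists U, val (marked_code U) == val T.
    by have [U <-] := marked_code_surj T hn; exists U.
  (* The inverse sends a star tubing to the class of a chosen preimage; different preimages are
     equivalent by [marked_codeE]. *)
  exists (fun T => \pi_Q (xchoose (code_ex T)))%qT => [x|T].
    rewrite -[RHS]reprK; apply/eqP; rewrite piE; apply/marked_codeE/val_inj/eqP.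
    exact: (xchooseP (code_ex _)).
  apply/val_inj/esym; rewrite -[LHS](eqP (xchooseP (code_ex T))).
  by congr val; apply/marked_codeE; rewrite -piE reprK.
move=> x y; apply/idP/idP => [/existsP[U /existsP[V /and3P[]]]|].
  rewrite -{1}[x]reprK -{1}[y]reprK !piE => /marked_codeE <- /marked_codeE <- leUV.
  by apply/marked_code_le; exists U => //; apply: compo_equiv_refl.
(* Only the representative of [x] has to be changed: [repr y] itself serves as the upper one. *)
case/marked_code_le => U xU leU; apply/existsP; exists U; apply/existsP; exists (repr (y : Q)).
rewrite leU -{1}[x]reprK -{2}[y]reprK !piE compo_equiv_sym xU.
by rewrite compo_equiv_refl.
Qed.
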